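(* Let $n\ge 1$ and $\delta\in(0,1/2)$. Suppose that: (a) $(X,Y),(X_1,Y_1),\dots,(X_n,Y_n)$ are independent and identically distributed; (b) conditionally on $X$, the noise $\varepsilon=Y-g(X)$ is sub-Gaussian with parameter $\sigma^2>0$, that is, $\mathbb E[\varepsilon\mid X]=0$ and $\mathbb E[\exp(\lambda\varepsilon)\mid X]\le \exp(\lambda^2\sigma^2/2)$ for all $\lambda\in\mathbb R$; (c) $g$ is $L$-Lipschitz on $S_X$, i.e. $|g(x)-g(y)|\le L\|x-y\|_2$ for all $x,y\in S_X$; (d) the local map $\mathcal V$ is VC with dimension $v$. Then, with probability at least $1-2\delta$, for all $x\in S_X$, $$|\hat g_{\mathcal V}(x)-g(x)|\le \sqrt{\frac{2\sigma^2}{nP_n^X(\mathcal V(x))}\log\left(\frac{(n+1)^v}{\delta}\right)}+L(\mathcal V(x))\,\mathrm{diam}(\mathcal V(x)).$$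
   Context: $(X,Y)$ is a random vector with $X\in S_X\subset\mathbb R^d$ ($d\ge1$) and $Y\in\mathbb R$; $g(x)=\mathbb E[Y\mid X=x]$ for $x\in S_X$. For a Borel set $A\subset S_X$, $nP_n^X(A)=\sum_{i=1}^n \mathbf 1_A(X_i)$. A local map is a mapping $\mathcal V:S_X\to\mathcal B(S_X)$ (Borel subsets of $S_X$) with $x\in\mathcal V(x)$ for all $x\in S_X$. It may be random and may depend arbitrarily on the full sample $(X_i,Y_i)_{i\le n}$ and on additional randomness. The associated estimator is $$\hat g_{\mathcal V}(x)=\frac{\sum_{i=1}^nY_i\mathbf 1_{\mathcal V(x)}(X_i)}{\sum_{i=1}^n\mathbf 1_{\mathcal V(x)}(X_i)},\qquad 0/0=0.$$ For a collection $\mathcal A$ of subsets of $\mathbb R^d$, the shattering coefficient $\mathbb S_{\mathcal A}(n)$ is the supremum over all collections of $n$ distinct points $z_1,\dots,z_n\in\mathbb R^d$ of the cardinality of $\{(\mathbf 1_A(z_1),\dots,\mathbf 1_A(z_n)):A\in\mathcal A\}$, and $vc(\mathcal A)=\max\{n\ge1:\mathbb S_{\mathcal A}(n)=2^n\}$. The local map $\mathcal V$ is VC with dimension $v$ if there is a fixed (deterministic) collection $\mathcal A$ of sets in $\mathbb R^d$ with $vc(\mathcal A)=v$ such that $\{\mathcal V(x):x\in S_X\}\subset\mathcal A$. For $V\subset S_X$, $L(V)$ is the smallest constant $\ell$ such that $|g(x)-g(y)|\le \ell\|x-y\|_2$ for all $x,y\in V$, and $\mathrm{diam}(V)=\sup_{x,y\in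 V}\|x-y\|_2$. The right-hand side is read as $+\infty$ when $P_n^X(\mathcal V(x))=0$.
   Formalization: Adds that, for each 0/1 vector b, the event that some set of the VC collection cuts out b on X_1,...,X_n is measurable for the completion of the sigma-algebra generated by X_1,...,X_n; without such a condition the bound can fail for pathological VC collections. *)

(* Defs.v *)
(* MathComp / MathComp-Analysis *)
From HB Require Import structures.
From mathcomp Require Import all_boot all_order all_algebra.
From mathcomp Require Import all_classical all_reals all_analysis.
Set Implicit Arguments.
Unset Strict Implicit.
Unset Printing Implicit Defensive.
Import Order.TTheory GRing.Theory Num.Theory.
Import numFieldNormedType.Exports.
Local Open Scope classical_set_scope.
Local Open Scope ring_scope.

(* R^d is [d.-tuple R]: the library's sigma-algebra on tuples is the product
   one, i.e. the Borel sets of R^d. *)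

Section Geometry.
Context (R : realType) (d : nat).
Implicit Types (x y : d.-tuple R) (V S : set (d.-tuple R)).

Definition dist2 x y : R :=
  Num.sqrt (\sum_(i < d) (tnth x i - tnth y i) ^+ 2).

Definition lipschitz2_on (g : d.-tuple R -> R) (l : R) V : Prop :=
  forall x y, V x -> V y -> `|g x - g y| <= l * dist2 x y.

(* Only constants l >= 0 are considered: on a singleton every real l is
   admissible and there would be no smallest one. *)
Definition lip_const (g : d.-tuple R -> R) V : \bar R :=
  ereal_inf [set l%:E | l in [set l : R | 0 <= l /\ lipschitz2_on g l V]].

Definition diam V : \bar R :=
  ereal_sup [set (dist2 xy.1 xy.2)%:E | xy in V `*` V].

Definition local_map S (V : d.-tuple R -> set (d.-tuple R)) : Prop :=
  forall x, S x -> [/\ V x x, V x `<=` S & measurable (V x)].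

End Geometry.

Section VC.
Context (T : Type).
Implicit Type A : set (set T).

Definition traces A m (z : 'I_m -> T) : {set {ffun 'I_m -> bool}} :=
  [set b : {ffun 'I_m -> bool}
     | `[< exists2 C, A C & forall i, b i = `[< C (z i) >] >]]%SET.

(* The supremum over all m-point configurations is taken as a finite maximum,
   since there are at most 2 ^ m traces. *)
Definition shatter_coef A (m : nat) : nat :=
  \max_(k < (2 ^ m).+1 |
     `[< exists z : 'I_m -> T, injective z /\ #|traces A z| = k >]) k.

(* v is the largest m with shatter_coef A m = 2 ^ m. Allowing m = 0 makes the
   dimension of a nonempty class that shatters no singleton equal to 0. *)
Definition vc_dimension A (v : nat) : Prop :=
  shatter_coef A v = (2 ^ v)%N /\
  forall m, shatter_coef A m = (2 ^ m)%N -> (m <= v)%N.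

End VC.

Section Probability.
Context (dO : measure_display) (Omega : measurableType dO) (R : realType).
Context (P : probability Omega R).

Definition mutually_independent dT (T : measurableType dT) (I : finType)
    (Z : I -> Omega -> T) : Prop :=
  forall (J : {set I}) (B : I -> set T), (forall i, measurable (B i)) ->
    P (\bigcap_(i in [set i | i \in J]) Z i @^-1` B i) =
    (\prod_(i in J) P (Z i @^-1` B i))%E.

Definition identically_distributed dT (T : measurableType dT) (I : Type)
    (Z : I -> Omega -> T) : Prop :=
  forall (i j : I) (B : set T), measurable B ->
    P (Z i @^-1` B) = P (Z j @^-1` B).

Definition iid dT (T : measurableType dT) (I : finType)
    (Z : I -> Omega -> T) : Prop :=
  mutually_independent Z /\ identically_distributed Z.

(* The generic pair (X, Y), at index None, followed by the sample. *)
Definition with_sample (T U : Type) (n : nat) (X : Omega -> T) (Y : Omega -> U)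
    (Xs : 'I_n -> Omega -> T) (Ys : 'I_n -> Omega -> U)
    (i : option 'I_n) (w : Omega) : T * U :=
  if i is Some j then (Xs j w, Ys j w) else (X w, Y w).

(* h(X) is a version of E[Z | X]. *)
Definition is_cond_expectation dT (T : measurableType dT)
    (X : Omega -> T) (Z : Omega -> R) (h : T -> R) : Prop :=
  [/\ P.-integrable setT (EFin \o Z),
      measurable_fun setT h,
      P.-integrable setT (EFin \o (h \o X)) &
      forall B, measurable B ->
        (\int[P]_(w in X @^-1` B) (Z w)%:E =
         \int[P]_(w in X @^-1` B) (h (X w))%:E)%E].

Definition cond_subgaussian dT (T : measurableType dT)
    (X : Omega -> T) (eps : Omega -> R) (sigma : R) : Prop :=
  is_cond_expectation X eps (cst 0) /\
  forall lambda : R, exists2 h : T -> R,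
    is_cond_expectation X (fun w => expR (lambda * eps w)) h &
    {ae P, forall w, h (X w) <= expR (lambda ^+ 2 * sigma ^+ 2 / 2)}.

(* For every 0/1 vector b, the event that some member of the class A cuts out b
   on the points X_1, ..., X_n lies in the P-completion of sigma(X_1, ..., X_n).
   For an uncountable class this is not automatic, and uniform deviation bounds
   can fail without it: under the continuum hypothesis, the initial segments of
   a well-order of [0, 1] of type omega_1 are Borel, form a class of VC
   dimension 1, and cut out each b on an event of outer probability one when
   the X_i are uniform. *)
Definition measurable_traces dT (T : measurableType dT) (n : nat)
    (X : 'I_n -> Omega -> T) (A : set (set T)) : Prop :=
  forall b : {ffun 'I_n -> bool},
    let F := [set w | b \in traces A (fun i => X i w)] in
    exists2 G, g_sigma_preimage X G & P.-negligible ((F `\` G) `|` (G `\` F)).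

End Probability.

Section Estimator.
Context (R : realType) (d n : nat).
Variables (X : 'I_n -> d.-tuple R) (Y : 'I_n -> R).

(* n P_n^X(V) *)
Definition local_count (V : set (d.-tuple R)) : R := \sum_(i < n) \1_V (X i).

(* 0 / 0 = 0 by the library's convention on inverses. *)
Definition local_estimator (V : d.-tuple R -> set (d.-tuple R))
    (x : d.-tuple R) : R :=
  (\sum_(i < n) Y i * \1_(V x) (X i)) / (\sum_(i < n) \1_(V x) (X i)).

(* With L(V) = 0 and diam V = +oo the product is 0. *)
Definition local_bound (g : d.-tuple R -> R) (sigma delta : R) (v : nat)
    (V : set (d.-tuple R)) : \bar R :=
  if local_count V == 0 then +oo%E else
  ((Num.sqrt (2 * sigma ^+ 2 / local_count V
              * ln (n.+1%:R ^+ v / delta)))%:E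
   + lip_const g V * diam V)%E.

End Estimator.

(* Main.v *)
(* On the sample, a local map enters the estimator only through the 0/1 vector b
   that V(x) cuts out on X_1, ..., X_n. For a fixed b, the weighted noise
   sum_i b_i eps_i is sub-Gaussian even on an event G of sigma(X_1, ..., X_n), so
   it exceeds its threshold on G with probability at most
   2 delta (n+1)^-v P(G). Taking for G the event G_b that the class cuts out b,
   the union bound gives 2 delta (n+1)^-v sum_b P(G_b), and sum_b P(G_b) is the
   expected number of traces, at most (n+1)^v by the Sauer-Shelah lemma. No
   symmetrization is needed, since the number of traces is counted on the sample
   itself. The bias is at most L(V(x)) diam(V(x)) because V(x) contains x. *)
Require Import Defs.
From HB Require Import structures.
From mathcomp Require Import all_boot all_order all_algebra.
From mathcomp Require Import all_classical all_reals all_analysis.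
From mathcomp Require Import measurable_realfun ring.
Set Implicit Arguments.
Unset Strict Implicit.
Unset Printing Implicit Defensive.
Import Order.TTheory GRing.Theory Num.Theory.
Import numFieldNormedType.Exports.
Local Open Scope classical_set_scope.
Local Open Scope ring_scope.

(** * Sauer-Shelah lemma *)

Section Sauer.
Variable I : finType.
Implicit Types (F : {set {ffun I -> bool}}) (J : {set I}).

Definition shattered F J : bool :=
  [forall b : {ffun I -> bool}, exists c in F, forall i in J, c i == b i].

Lemma shatteredP F J :
  reflect (forall b : {ffun I -> bool},
            exists2 c, c \in F & {in J, forall i, c i = b i})
          (shattered F J).
Proof.
apply: (iffP forallP) => h b.
  have /exists_inP[c cF /forall_inP cb] := h b.
  by exists c => // i /cb/eqP.
apply/exists_inP; have [c cF cb] := h b.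
by exists c => //; apply/forall_inP => i /cb ->.
Qed.

Lemma shatteredS F F' J : F \subset F' -> shattered F J -> shattered F' J.
Proof.
move=> /fintype.subsetP FF' /shatteredP h; apply/shatteredP => b.
by have [c /FF' cF cb] := h b; exists c.
Qed.

Lemma shattered_constant F J (x : I) (e : bool) :
  {in F, forall c : {ffun I -> bool}, c x = e} -> shattered F J -> x \notin J.
Proof.
move=> Fx /shatteredP h; apply/negP => xJ.
have [c cF /(_ x xJ)] := h [ffun=> ~~ e].
by rewrite ffunE Fx //; case: (e).
Qed.

(* Pajor's strengthening of the Sauer-Shelah lemma. A coordinate x on which F is
   not constant splits F into Fe true and Fe false; a set shattered by one of
   them avoids x, and x can be added to a set shattered by both. *)
Lemma card_le_shattered F : (#|F| <= #|[set J | shattered F J]%SET|)%N.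
Proof.
have [m] := ubnP #|F|; elim: m F => // m IH F /ltnSE Fm.
have [F_gt1|] := ltnP 1 #|F|; last first.
  have [->|F0 F1] := eqVneq F finset.set0; first by rewrite cards0.
  apply: (leq_trans F1); apply/card_gt0P; exists finset.set0; rewrite inE.
  have [c cF] := finset.set0Pn _ F0; apply/shatteredP => b.
  by exists c => // i; rewrite inE.
have [c [c' [cF c'F cc']]] := card_gt1P F_gt1.
have [x xcc'] : exists x, c x != c' x.
  apply/existsP; apply: contraR cc' => /existsPn cc'; apply/eqP/ffunP => x.
  by apply/eqP; have := cc' x; rewrite negbK.
pose Fe e := [set b in F | b x == e]%SET.
have FeS e : Fe e \subset F by apply/fintype.subsetP => b; rewrite inE => /andP[].
have Fex e : {in Fe e, forall b : {ffun I -> bool}, b x = e}.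
  by move=> b; rewrite inE => /andP[_ /eqP].
have cardF : #|F| = (#|Fe true| + #|Fe false|)%N.
  rewrite -(cardsID [set b : {ffun I -> bool} | b x]%SET F).
  by congr (_ + _)%N; apply: eq_card => b; rewrite !inE; case: (b x); rewrite ?andbF ?andbT.
have Fe_gt0 e : (0 < #|Fe e|)%N.
  apply/card_gt0P; case: (eqVneq (c x) e) => cx.
    by exists c; rewrite inE cF cx eqxx.
  by exists c'; rewrite inE c'F /=; case: e (c x) (c' x) cx xcc' => [] [] [].
have Fe_lt e : (#|Fe e| < m)%N.
  apply: leq_trans Fm; rewrite cardF -addn1.
  by case: e; [rewrite leq_add2l|rewrite addnC leq_add2r].
pose sh e := [set J | shattered (Fe e) J]%SET.
have shx e J : J \in sh e -> x \notin J.
  by rewrite inE => /shattered_constant; apply; exact: Fex.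
rewrite cardF; apply: leq_trans (leq_add (IH _ (Fe_lt _)) (IH _ (Fe_lt _))) _.
rewrite -/(sh true) -/(sh false) -cardsUI.
(* The sets shattered by both halves are counted twice; adding [x] sends them injectively to sets
   containing [x], hence outside the union. *)
have inj_x : {in sh true :&: sh false &, injective (fun J => x |: J)%SET}.
  move=> J K /finset.setIP[/shx xJ _] /finset.setIP[/shx xK _] xJK.
  by rewrite -(finset.setU1K xJ) xJK finset.setU1K.
rewrite -(card_in_imset inj_x).
set U := (_ :|: _)%SET; set W := (_ @: _)%SET.
have UW : (U :&: W = finset.set0)%SET.
  apply/finset.setP => J; rewrite [RHS]inE.
  apply/negP => /finset.setIP[JU /imsetP[K _ JK]].
  have : x \notin J by case/finset.setUP: JU; exact: shx.
  by rewrite JK !inE eqxx.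
rewrite -cardsUI UW cards0 addn0; apply/subset_leq_card/fintype.subsetP => J.
case/finset.setUP => [/finset.setUP[]|].
- by rewrite !inE; exact: shatteredS.
- by rewrite !inE; exact: shatteredS.
move=> /imsetP[K /finset.setIP[]]; rewrite !inE => /shatteredP Kt /shatteredP Kf ->.
apply/shatteredP => b.
have [a aF ab] : exists2 a, a \in Fe (b x) & {in K, forall i, a i = b i}.
  by case: (b x); [exact: Kt|exact: Kf].
exists a; first exact: fintype.subsetP aF.
by move=> i /finset.setU1P[->|]; [exact: Fex|exact: ab].
Qed.

(** Each such set is the range of a map from [v] slots to [option I], with [None] in the slots left
    over. *)
Lemma card_small_sets v :
  (#|[set J : {set I} | #|J| <= v]%SET| <= #|I|.+1 ^ v)%N.
Proof.
pose range_set (f : {ffun 'I_v -> option I}) := [set i | Some i \in codom f]%SET.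
rewrite -card_option -[v in (_ ^ v)%N]card_ord -card_ffun.
apply: leq_trans (leq_imset_card range_set predT).
apply/subset_leq_card/fintype.subsetP => J; rewrite inE => Jv.
apply/imsetP; exists [ffun k : 'I_v => nth None (map Some (enum J)) k] => //.
apply/finset.setP => i; rewrite inE; apply/idP/codomP => [iJ|[k]].
  have iJ' : i \in enum J by rewrite mem_enum.
  have kv : (index i (enum J) < v)%N.
    by apply: leq_trans Jv; rewrite cardE index_mem.
  exists (Ordinal kv); rewrite ffunE /= (nth_map i) ?index_mem // nth_index //.
rewrite ffunE => ik.
have kJ : (k < size (enum J))%N.
  by rewrite ltnNge; apply/negP => h; rewrite nth_default ?size_map in ik.
move: ik; rewrite (nth_map i) // => -[->].
by rewrite -mem_enum mem_nth.
Qed.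

End Sauer.

(** * Traces of a VC class on a sample *)

Section VCbound.
Variables (T : Type) (A : set (set T)).

Lemma tracesP m (z : 'I_m -> T) (b : {ffun 'I_m -> bool}) :
  (b \in traces A z) <->
  exists2 C, A C & forall i, b i = `[< C (z i) >].
Proof. by rewrite inE; split=> [/asboolP|h]; last exact/asboolP. Qed.

(** Shattering separates the points indexed by [J], so they are distinct and form an admissible
    configuration for [shatter_coef]. *)
Lemma card_shattered_traces m (z : 'I_m -> T) J :
  shattered (traces A z) J -> shatter_coef A #|J| = (2 ^ #|J|)%N.
Proof.
move=> /shatteredP sh.
pose y (k : 'I_#|J|) := z (enum_val k).
have full : traces A y = [set: {ffun 'I_#|J| -> bool}]%SET.
  apply/finset.setP => b; rewrite [RHS]inE; apply/tracesP.
  (* The vector [b], given on [J], is extended by false to all indices. *)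
  have [c /tracesP[C AC cC] cb] :=
    sh [ffun i => [exists k : 'I_#|J|, (enum_val k == i) && b k]].
  exists C => // k; rewrite -cC cb ?enum_valP // ffunE.
  apply/idP/existsP => [bk|[l /andP[/eqP/enum_val_inj -> //]]].
  by exists k; rewrite eqxx.
have inj_y : injective y.
  move=> k l ykl; apply/eqP; apply: contraT => kl.
  have [c /tracesP[C AC cC] cb] := sh [ffun i => i == enum_val k].
  have := cC (enum_val k); rewrite -/(y k) ykl -cC.
  rewrite !cb ?enum_valP // !ffunE eqxx (inj_eq enum_val_inj) eq_sym.
  by rewrite (negbTE kl).
apply/eqP; rewrite eqn_leq; apply/andP; split.
  by apply/bigmax_leqP => k _; rewrite -ltnS.
have yE : #|traces A y| = (2 ^ #|J|)%N.
  by rewrite full cardsT card_ffun card_bool card_ord.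
apply: (bigop.leq_bigmax_cond (ord_max : 'I_(2 ^ #|J|).+1)).
by apply/asboolP; exists y.
Qed.

(* The points are not required to be distinct: equal points cannot be separated,
   so an index set on which all traces occur indexes distinct points. *)
Lemma card_traces v n (z : 'I_n -> T) :
  vc_dimension A v -> (#|traces A z| <= n.+1 ^ v)%N.
Proof.
move=> [_ vmax]; apply: leq_trans (card_le_shattered _) _.
rewrite -[n in (n.+1 ^ v)%N]card_ord.
apply: leq_trans (card_small_sets _ v).
apply/subset_leq_card/fintype.subsetP => J; rewrite !inE => /card_shattered_traces.
exact: vmax.
Qed.

End VCbound.

(** * Products of independent random variables *)

Section IntegralComp.
Context d1 d2 (Om : measurableType d1) (T : measurableType d2) (R : realType).
Variables (P : {measure set Om -> \bar R}) (Z : Om -> T).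
Hypothesis mZ : measurable_fun setT Z.

Import HBNNSimple.

(** Splitting over the finitely many level sets of [f] reduces simple functions to indicators of
    [Z]. *)
Lemma integral_mul_nnsfun_comp (U : Om -> R) (f : {nnsfun T >-> R}) :
  measurable_fun setT U -> (forall w, 0 <= U w) ->
  (\int[P]_w (U w * f (Z w))%:E =
   \sum_(y \in range f)
     (y%:E * \int[P]_w (U w * \1_(f @^-1` [set y]) (Z w))%:E))%E.
Proof.
move=> mU U0.
have mf1 y : measurable_fun setT (fun w => \1_(f @^-1` [set y]) (Z w) : R).
  by apply: (measurableT_comp _ mZ); exact: measurable_indic.
have f1_ge0 y w : 0 <= y * \1_(f @^-1` [set y]) (Z w).
  rewrite indicE; case: (boolP (_ \in _)); last by rewrite mulr0.
  by rewrite inE /= mulr1 => <-.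
transitivity (\int[P]_w
    \sum_(y \in range f) (U w * (y * \1_(f @^-1` [set y]) (Z w)))%:E)%E.
  apply: eq_integral => w _; rewrite fsbig_finite //= sumEFin -mulr_sumr.
  by rewrite {1}fimfunE fsbig_finite.
rewrite ge0_integral_fsum //; last 2 first.
- move=> y; apply/measurable_EFinP; apply: measurable_funM => //.
  by apply: measurable_funM => //; exact: mf1.
- by move=> y w _; rewrite lee_fin mulr_ge0.
apply: eq_fsbigr => y /set_mem[x _ <-].
rewrite -ge0_integralZl_EFin //.
- by apply: eq_integral => w _; rewrite -EFinM mulrCA.
- by move=> w _; rewrite lee_fin mulr_ge0 // indicE.
- by apply/measurable_EFinP; apply: measurable_funM => //; exact: mf1.
Qed.

(** On events of [Z], [U] behaves like a variable of mean [c] independent of [Z]. Linearity over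
    level sets and monotone convergence carry this from indicators to nonnegative functions. *)
Lemma ge0_integral_mul_comp (U : Om -> R) (c : R) (f : T -> R) :
  measurable_fun setT U -> (forall w, 0 <= U w) ->
  (forall B, measurable B ->
    \int[P]_w (U w * \1_B (Z w))%:E = c%:E * P (Z @^-1` B))%E ->
  measurable_fun setT f -> (forall x, 0 <= f x) ->
  (\int[P]_w (U w * f (Z w))%:E = c%:E * \int[P]_w (f (Z w))%:E)%E.
Proof.
move=> mU U0 Uc mf f0.
have mEf : measurable_fun setT (EFin \o f) by exact/measurable_EFinP.
pose f_ := nnsfun_approx measurableT mEf.
have f_cvg x : EFin \o f_^~ x @ \oo --> (f x)%:E.
  have Ef0 y : [set: T] y -> (0 <= (EFin \o f) y)%E by rewrite lee_fin.
  exact: (cvg_nnsfun_approx measurableT mEf Ef0 (x := x) Logic.I).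
have f_nd x : nondecreasing_seq (f_^~ x).
  by move=> m n mn; exact/lefP/nd_nnsfun_approx.
have mfZ n : measurable_fun setT (f_ n \o Z) by apply: measurableT_comp.
(* Applied with [U] on the left-hand side and with the constant 1 on the right-hand side. *)
have int_lim (W : Om -> R) : measurable_fun setT W -> (forall w, 0 <= W w) ->
    (\int[P]_w (W w * f (Z w))%:E =
     limn (fun n => \int[P]_w (W w * f_ n (Z w))%:E))%E.
  move=> mW W0; rewrite -monotone_convergence //.
  - apply: eq_integral => w _; apply/esym/cvg_lim => //.
    by under eq_fun do rewrite EFinM; rewrite EFinM; exact/cvgeZl/f_cvg.
  - by move=> n; apply/measurable_EFinP; apply: measurable_funM => //; exact: mfZ.
  - by move=> n w _; rewrite lee_fin mulr_ge0.
  - by move=> w _ m n mn; rewrite lee_fin ler_wpM2l // f_nd.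
rewrite int_lim //.
under [in RHS]eq_integral do rewrite -[f _]mul1r.
rewrite (int_lim (cst 1)) // -limeMl //; last first.
  apply: ereal_nondecreasing_is_cvgn => m n mn; apply: ge0_le_integral => //.
  - by move=> w _; rewrite lee_fin mul1r.
  - by apply/measurable_EFinP; apply: measurable_funM => //; exact: mfZ.
  - by apply/measurable_EFinP; apply: measurable_funM => //; exact: mfZ.
  - by move=> w _; rewrite lee_fin !mul1r f_nd.
apply/congr_lim/funext => n /=.
rewrite (integral_mul_nnsfun_comp (U := cst 1)) // integral_mul_nnsfun_comp //.
rewrite ge0_mule_fsumr; last first.
  (* Distributing [c] over the sum requires nonnegative terms; for negative [y] the level set is
     empty and the term is zero. *)
  move=> y; have [y0|y0] := leP 0 y.
    by rewrite mule_ge0 ?lee_fin // integral_ge0 // => w _; rewrite lee_fin mul1r indicE.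
  rewrite preimage_nnfun0 // integral0_eq ?mule0 // => w _.
  by rewrite indic0 mulr0.
apply: eq_fsbigr => y _.
have mB : measurable (f_ n @^-1` [set y]) by exact: measurable_sfunP.
rewrite Uc // muleCA; congr (_ * (_ * _))%E.
under eq_integral do rewrite mul1r.
rewrite -[X in P X]setIT -integral_indic //.
by rewrite -[X in measurable X]setTI; exact: mZ.
Qed.
End IntegralComp.

Section ProductExpectation.
Context d1 d2 (Om : measurableType d1) (T : measurableType d2) (R : realType).
Variables (P : probability Om R) (I : finType) (Z : I -> Om -> T).
Hypothesis mZ : forall i, measurable_fun setT (Z i).
Hypothesis indepZ : mutually_independent P Z.

Lemma ge0_integral_prod_independent (f : I -> T -> R) :
  (forall i, measurable_fun setT (f i)) -> (forall i x, 0 <= f i x) ->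
  (forall i, \int[P]_w (f i (Z i w))%:E < +oo)%E ->
  (\int[P]_w (\prod_i f i (Z i w))%:E = \prod_i \int[P]_w (f i (Z i w))%:E)%E.
Proof.
(* The factors outside s are indicators; independence is the case s = [::], and
   each step replaces one indicator by a general function. *)
suff indicS (s : seq I) : forall f : I -> T -> R,
    (forall i, measurable_fun setT (f i)) -> (forall i x, 0 <= f i x) ->
    (forall i, \int[P]_w (f i (Z i w))%:E < +oo)%E ->
    (forall i, i \notin s -> exists2 B, measurable B & f i = \1_B) ->
    (\int[P]_w (\prod_i f i (Z i w))%:E =
     \prod_i \int[P]_w (f i (Z i w))%:E)%E.
  by move=> mf f0 foo; apply: (indicS (index_enum I)) => // i; rewrite mem_index_enum.
have integral_indic_comp i B : measurable B ->
    (\int[P]_w (\1_B (Z i w))%:E = P (Z i @^-1` B))%E.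
  move=> mB; rewrite -[X in P X]setIT -integral_indic //.
  by rewrite -[X in measurable X]setTI; exact: mZ.
elim: s => [|j s IH] {}f mf f0 foo findic.
  have /choice[B fB] i : exists B, measurable B /\ f i = \1_B.
    by have [//|B mB ->] := findic i; exists B.
  have mB i : measurable (B i) by have [] := fB i.
  have {fB}fB i : f i = \1_(B i) by have [] := fB i.
  under [in RHS]eq_bigr do rewrite fB integral_indic_comp //.
  have := indepZ finset.setT mB.
  under [in RHS]eq_bigl do rewrite finset.in_setT.
  move=> <-; set D := (X in P X).
  have mD : measurable D.
    apply: fin_bigcap_measurable; first exact: finite_finset.
    by move=> i _; rewrite -[X in measurable X]setTI; exact: mZ.
  rewrite -[X in P X]setIT -integral_indic //.
  apply: eq_integral => w _; congr EFin; rewrite indicE.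
  have [wD|wD] := boolP (w \in D).
    rewrite big1 // => i _; rewrite fB indicE mem_set //.
    by move: wD; rewrite inE => /(_ i); apply; rewrite /= finset.in_setT.
  have [i wi] : exists i, ~ B i (Z i w).
    apply/existsNP => h; move: wD; rewrite notin_setE; apply => i _; exact: h.
  by rewrite (bigD1 i) //= fB indicE memNset // mul0r.
under eq_integral do rewrite (bigD1 j) //= mulrC.
pose U w := \prod_(i | i != j) f i (Z i w).
have U0 w : 0 <= U w by apply: prodr_ge0.
have mU : measurable_fun setT U.
  have -> : U = (fun w => \prod_i (if i != j then f i (Z i w) else 1)).
    by apply/funext => w; rewrite /U big_mkcond.
  by apply: measurable_prod => i _; case: (i != j) => //; exact: measurableT_comp.
have Ef_fin i : (\int[P]_w (f i (Z i w))%:E)%E \is a fin_num.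
  by rewrite ge0_fin_numE // integral_ge0 // => w _; rewrite lee_fin.
have /EFin_fin_numP[c cE] :
    (\prod_(i | i != j) \int[P]_w (f i (Z i w))%:E)%E \is a fin_num.
  exact: prode_fin_num.
rewrite (bigD1 j) //= cE muleC.
apply: ge0_integral_mul_comp => // B mB.
(* The hypothesis of [ge0_integral_mul_comp] on indicators is the induction hypothesis for [f'],
   whose j-th factor is the indicator of [B]. *)
pose f' i := if i == j then \1_B else f i.
transitivity (\int[P]_w (\prod_i f' i (Z i w))%:E)%E.
  apply: eq_integral => w _; rewrite [in RHS](bigD1 j) //= {1}/f' eqxx mulrC.
  by rewrite /U; congr (_ * _)%:E; apply: eq_bigr => i /negbTE ij; rewrite /f' ij.
have f'0 i x : 0 <= f' i x by rewrite /f'; case: ifP => _ //; rewrite indicE.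
rewrite IH //; first last.
- move=> i is_; rewrite /f'; case: eqVneq => [_|ij]; first by exists B.
  by apply: findic; rewrite inE negb_or ij.
- move=> i; rewrite /f'; case: eqP => // _.
  rewrite integral_indic_comp //.
  apply: (le_lt_trans (probability_le1 _ _)); last exact: ltry.
  by rewrite -[X in measurable X]setTI; exact: mZ.
- by move=> i; rewrite /f'; case: eqP => // _; exact: measurable_indic.
rewrite (bigD1 j) //= {1}/f' eqxx integral_indic_comp // muleC -cE; congr (_ * _)%E.
by apply: eq_bigr => i /negbTE ij; rewrite /f' ij.
Qed.

End ProductExpectation.

Section IdenticallyDistributed.
Context d1 d2 (Om : measurableType d1) (T : measurableType d2) (R : realType).
Variables (P : probability Om R).

Lemma ge0_integral_same_law (Z Z' : Om -> T) (f : T -> R) :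
  measurable_fun setT Z -> measurable_fun setT Z' ->
  (forall B, measurable B -> P (Z @^-1` B) = P (Z' @^-1` B)) ->
  measurable_fun setT f -> (forall x, 0 <= f x) ->
  (\int[P]_w (f (Z w))%:E = \int[P]_w (f (Z' w))%:E)%E.
Proof.
move=> mZ mZ' ZZ' mf f0.
have mEf : measurable_fun setT (EFin \o f) by exact/measurable_EFinP.
have Ef0 : {in [set: T], forall y, (0 <= (EFin \o f) y)%E}.
  by move=> y _; rewrite lee_fin.
have := ge0_integral_pushforward mZ P measurableT mEf Ef0.
have := ge0_integral_pushforward mZ' P measurableT mEf Ef0.
rewrite !preimage_setT => <- <-.
by apply: eq_measure_integral => B mB _; exact: ZZ'.
Qed.

End IdenticallyDistributed.

(** * Domination conditionally on the design points *)

Lemma integral_preimage_indic d1 T (Om : measurableType d1) (R : realType)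
    (P : {measure set Om -> \bar R}) (U : Om -> T) (B : set T) (F : T -> R) :
  (\int[P]_(w in U @^-1` B) (F (U w))%:E =
   \int[P]_w (F (U w) * \1_B (U w))%:E)%E.
Proof.
rewrite integral_mkcond; apply: eq_integral => w _; rewrite indicE.
rewrite patchE (_ : (w \in _) = (U w \in B)); last by apply/idP/idP; rewrite !inE.
by case: ifP; rewrite (mulr1, mulr0).
Qed.

Section ClippedConditionalExpectation.
Context d1 d2 (Om : measurableType d1) (T : measurableType d2) (R : realType).
Variables (P : probability Om R) (X : Om -> T).
Hypothesis mX : measurable_fun setT X.

(* A version of E[W | X] can be negative or exceed C on a null set only. *)
Lemma ge0_cond_expectation_clip (W : Om -> R) (h : T -> R) (C : R) :
  0 <= C -> (forall w, 0 <= W w) -> is_cond_expectation P X W h ->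
  {ae P, forall w, h (X w) <= C} ->
  exists k : T -> R, [/\ measurable_fun setT k, forall x, 0 <= k x <= C &
    forall B, measurable B ->
      (\int[P]_(w in X @^-1` B) (W w)%:E =
       \int[P]_(w in X @^-1` B) (k (X w))%:E)%E].
Proof.
move=> C0 W0 [/measurable_int/measurable_EFinP mW mh ih hE] hC.
have mXB B : measurable B -> measurable (X @^-1` B).
  by move=> mB; rewrite -[X in measurable X]setTI; exact: mX.
pose k0 x := Num.max (h x) 0; pose k x := Num.min (k0 x) C.
have mk0 : measurable_fun setT k0 by exact: measurable_maxr.
have mk : measurable_fun setT k by exact: measurable_minr.
exists k; split => // [x|B mB].
  by rewrite /k ge_min lexx orbT le_min C0 andbT le_max lexx orbT.
pose N := [set x | h x < 0].
have mN : measurable N.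
  rewrite (_ : N = h @^-1` `]-oo, 0[%classic).
    by rewrite -[X in measurable X]setTI; exact: mh.
  by apply/seteqP; split => x /=; rewrite in_itv.
have WN : (\int[P]_(w in X @^-1` N) (W w)%:E = 0)%E.
  apply/eqP; rewrite eq_le; apply/andP; split; last first.
    by apply: integral_ge0 => w _; rewrite lee_fin.
  rewrite hE // (eq_integral (fun w => - (- h (X w))%:E)%E); last first.
    by move=> w _; rewrite EFinN oppeK.
  have hN w : (X @^-1` N) w -> (0 <= (- h (X w))%:E)%E.
    by move=> /ltW hw; rewrite lee_fin oppr_ge0.
  by rewrite integral_ge0N // oppe_le0; exact: integral_ge0.
have split_int (F : Om -> R) : measurable_fun setT F -> (forall w, 0 <= F w) ->
    (\int[P]_(w in X @^-1` B) (F w)%:E =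
     \int[P]_(w in X @^-1` (B `&` N)) (F w)%:E +
     \int[P]_(w in X @^-1` (B `\` N)) (F w)%:E)%E.
  move=> mF F0; rewrite -[in LHS](setUIDK B N) preimage_setU ge0_integral_setU //.
  - by apply: mXB; exact: measurableI.
  - by apply: mXB; exact: measurableD.
  - by apply: measurable_funTS; exact/measurable_EFinP.
  - by move=> w _; rewrite lee_fin.
  - rewrite disj_set2E; apply/eqP/seteqP; split=> // w [[_ wN] [_ wN']].
    exact: wN' wN.
(* Capping at [C] changes [k0] along [X] only on a null set, so it remains to compare [W] with the
   positive part [k0]. *)
transitivity (\int[P]_(w in X @^-1` B) (k0 (X w))%:E)%E; last first.
  apply: ge0_ae_eq_integral.
  - exact: mXB.
  - by apply/measurable_funTS/measurable_EFinP; exact: measurableT_comp.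
  - by apply/measurable_funTS/measurable_EFinP; exact: measurableT_comp.
  - by move=> w _; rewrite lee_fin le_max lexx orbT.
  - by move=> w _; rewrite lee_fin le_min C0 andbT le_max lexx orbT.
  - apply: filterS hC => w hC _; congr EFin.
    by apply/esym/min_idPl; rewrite ge_max hC.
rewrite split_int // [RHS]split_int; last 2 first.
- exact: measurableT_comp.
- by move=> w; rewrite le_max lexx orbT.
congr (_ + _)%E.
- rewrite [RHS]integral0_eq; last first.
    by move=> w [_ /= /ltW hw]; congr EFin; apply/max_idPr.
  apply/eqP; rewrite eq_le; apply/andP; split; last first.
    by apply: integral_ge0 => w _; rewrite lee_fin.
  rewrite -WN; apply: ge0_subset_integral.
  - by apply: mXB; exact: measurableI.
  - exact: mXB.
  - by apply: measurable_funTS; exact/measurable_EFinP.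
  - by move=> w _; rewrite lee_fin.
  - by move=> w [].
- rewrite hE; last exact: measurableD.
  apply: eq_integral => w; rewrite inE => -[_ /= /negP hw]; congr EFin.
  by apply/esym/max_idPl; rewrite leNgt.
Qed.

End ClippedConditionalExpectation.

Lemma g_sigma_preimage_measurable d1 d2 (Om : measurableType d1)
    (T : measurableType d2) n (f : 'I_n -> Om -> T) :
  (forall i, measurable_fun setT (f i)) -> g_sigma_preimage f `<=` measurable.
Proof.
move=> mf; apply: smallest_sub; first exact: sigma_algebra_measurable.
apply: (big_ind (fun K : set (set Om) => K `<=` measurable)) => //.
- by move=> K K' mK mK' D [/mK|/mK'].
- by move=> i _ _ [B mB <-]; exact: mf.
Qed.

Section ConditionalProduct.
Context d1 d2 d3 (Om : measurableType d1) (T : measurableType d2)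
  (T' : measurableType d3) (R : realType).
Variables (P : probability Om R) (n : nat) (Z : 'I_n -> Om -> T) (p : T -> T').
Hypothesis mZ : forall i, measurable_fun setT (Z i).
Hypothesis indepZ : mutually_independent P Z.
Hypothesis mp : measurable_fun setT p.

(** Rectangles in the variables [p (Z i w)] form a pi-system whose generated sigma-algebra contains
    that of these variables. In the application [p] projects a pair to its design point. *)
Let rect (B : 'I_n -> set T') := [set w | forall i, B i (p (Z i w))].
Let rects := [set D | exists2 B, (forall i, measurable (B i)) & D = rect B].

Let measurable_rect B : (forall i, measurable (B i)) -> measurable (rect B).
Proof.
move=> mB; rewrite (_ : rect B = \bigcap_(i in setT) (p \o Z i) @^-1` B i).
  apply: fin_bigcap_measurable; first exact: finite_finset.
  move=> i _; rewrite -[X in measurable X]setTI.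
  by apply: (measurableT_comp mp (mZ i)).
by apply/seteqP; split=> w /= wB i; [move=> _|]; exact: wB.
Qed.

Let rects_measurable : rects `<=` measurable.
Proof. by move=> _ [B mB ->]; exact: measurable_rect. Qed.

Let rectsI : setI_closed rects.
Proof.
move=> _ _ [B mB ->] [C mC ->]; exists (fun i => B i `&` C i).
  by move=> i; exact: measurableI.
by apply/seteqP; split=> [w [wB wC] i|w wBC]; split=> // i; have [] := wBC i.
Qed.

Let rectsT : rects setT.
Proof. by exists (fun=> setT) => //; apply/seteqP; split. Qed.

Let preimage_rects : g_sigma_preimage (fun i => p \o Z i) `<=` <<s rects >>.
Proof.
apply: smallest_sub; first exact: smallest_sigma_algebra.
apply: (big_ind (fun K : set (set Om) => K `<=` <<s rects >>)) => //.
- by move=> K K' sK sK' D [/sK|/sK'].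
- move=> i _ _ [B mB <-]; apply: sub_sigma_algebra.
  exists (fun j => if j == i then B else setT).
    by move=> j; case: ifP.
  rewrite setTI; apply/seteqP; split=> w /= wB.
    by move=> j; case: eqP => // ->.
  by have := wB i; rewrite eqxx.
Qed.

(** Each constraint [B i] bears on one variable only, so its indicator is absorbed into the i-th
    factor and independence still applies. *)
Let integral_rect (f : 'I_n -> T -> R) B :
  (forall i, measurable_fun setT (f i)) -> (forall i x, 0 <= f i x) ->
  (forall i, \int[P]_w (f i (Z i w))%:E < +oo)%E ->
  (forall i, measurable (B i)) ->
  (\int[P]_(w in rect B) (\prod_i f i (Z i w))%:E =
   \prod_i \int[P]_(w in (p \o Z i) @^-1` B i) (f i (Z i w))%:E)%E.
Proof.
move=> mf f0 foo mB.
have mpB i : measurable (p @^-1` B i).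
  by rewrite -[X in measurable X]setTI; exact: mp.
pose fB i x := f i x * \1_(p @^-1` B i) x.
have fB0 i x : 0 <= fB i x by rewrite mulr_ge0 // indicE.
have mfB i : measurable_fun setT (fB i).
  by apply: measurable_funM => //; exact: measurable_indic.
have fBE i : (\int[P]_(w in (p \o Z i) @^-1` B i) (f i (Z i w))%:E =
    \int[P]_w (fB i (Z i w))%:E)%E.
  exact: (integral_preimage_indic P (Z i)).
under [RHS]eq_bigr do rewrite fBE.
rewrite -(ge0_integral_prod_independent mZ indepZ) //; last first.
  move=> i; apply: le_lt_trans (foo i); apply: ge0_le_integral => //.
  - by move=> w _; rewrite lee_fin.
  - by apply/measurable_EFinP; exact: measurableT_comp.
  - by apply/measurable_EFinP; exact: measurableT_comp.
  - by move=> w _; rewrite lee_fin ler_piMr // indicE lern1 leq_b1.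
rewrite integral_mkcond; apply: eq_integral => w _; rewrite patchE.
case: ifPn => [|/negP wB].
  rewrite inE => wB; congr EFin; apply: eq_bigr => i _.
  by rewrite /fB indicE mem_set ?mulr1 //; exact: wB.
have [i wi] : exists i, ~ B i (p (Z i w)).
  by apply/existsNP => h; apply: wB; rewrite inE.
by rewrite (bigD1 i) //= {1}/fB indicE memNset // mulr0 mul0r.
Qed.

(** By independence, the product of the conditional means [h i] is the conditional mean of the
    product given all the [p (Z i w)]. Both products thus have the same integral over [G], and each
    [h i] is at most [C i]. *)
Lemma ge0_integral_prod_dominated (f : 'I_n -> T -> R) (h : 'I_n -> T' -> R)
    (C : 'I_n -> R) G :
  (forall i, measurable_fun setT (f i)) -> (forall i x, 0 <= f i x) ->
  (forall i, measurable_fun setT (h i)) -> (forall i x, 0 <= h i x <= C i) ->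
  (forall i B, measurable B ->
    \int[P]_(w in (p \o Z i) @^-1` B) (f i (Z i w))%:E =
    \int[P]_(w in (p \o Z i) @^-1` B) (h i (p (Z i w)))%:E)%E ->
  g_sigma_preimage (fun i => p \o Z i) G ->
  (\int[P]_(w in G) (\prod_i f i (Z i w))%:E <= (\prod_i C i)%:E * P G)%E.
Proof.
move=> mf f0 mh h0C fh GX.
have h0 i x : 0 <= h i x by case/andP: (h0C i x).
have hC i x : h i x <= C i by case/andP: (h0C i x).
have mhp i : measurable_fun setT (h i \o p) by exact: measurableT_comp.
have hoo i : (\int[P]_w (h i (p (Z i w)))%:E < +oo)%E.
  apply: (@le_lt_trans _ _ (\int[P]_w (C i)%:E)%E).
    apply: ge0_le_integral => //.
    - by move=> w _; rewrite lee_fin.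
    - by apply/measurable_EFinP; exact: (measurableT_comp (mhp i) (mZ i)).
    - by move=> w _; rewrite lee_fin.
  by rewrite integral_cst // [X in (_ * X)%E](probability_setT P) mule1 ltry.
have foo i : (\int[P]_w (f i (Z i w))%:E < +oo)%E.
  by have := fh i setT measurableT; rewrite preimage_setT => ->.
(* The integrals, as functions of their domain, are packaged as measures so that uniqueness on a
   pi-system applies. *)
pose density (F : Om -> R) (A : set Om) := (\int[P]_(w in A) (F w)%:E)%E.
have densityP (F : Om -> R) : measurable_fun setT F -> (forall w, 0 <= F w) ->
    exists m : {measure set Om -> \bar R}, m = density F :> (set Om -> \bar R).
  move=> mF F0.
  have m0 : density F set0 = 0%E by rewrite /density integral_set0.
  have m_ge0 A : (0 <= density F A)%E.
    by apply: integral_ge0 => w _; rewrite lee_fin.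
  have m_add : semi_sigma_additive (density F).
    move=> A mA tA mUA; rewrite /density ge0_integral_bigcup //.
    - by apply: is_cvg_ereal_nneg_natsum_cond => k _ _; exact: m_ge0.
    - by apply/measurable_funTS/measurable_EFinP.
    - by move=> w _; rewrite lee_fin.
  pose mix := isMeasure.Build _ _ _ (density F) m0 m_ge0 m_add.
  by exists (HB.pack_for {measure set Om -> \bar R} (density F) mix).
have mprod (k : 'I_n -> T -> R) : (forall i, measurable_fun setT (k i)) ->
    measurable_fun setT (fun w => \prod_i k i (Z i w)).
  by move=> mk; apply: measurable_prod => i _; exact: measurableT_comp.
have [m1 m1E] := densityP _ (mprod _ mf) (fun w => prodr_ge0 _ (fun i _ => f0 i _)).
have [m2 m2E] := densityP _ (mprod _ mhp) (fun w => prodr_ge0 _ (fun i _ => h0 i _)).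
(* An inequality between measures does not extend from the rectangles to the
   sigma-algebra they generate, an equality does: hence the detour through h. *)
have m12 : m1 G = m2 G.
  apply: (g_sigma_algebra_measure_unique rects rects_measurable (fun=> setT)
    (fun=> rectsT) _ m1 m2 rectsI _ _ G (preimage_rects GX)).
  - by rewrite bigcup_const.
  - move=> _ [B mB ->]; rewrite m1E m2E /density integral_rect //.
    rewrite (integral_rect (f := fun i => h i \o p)) //; last first.
      by move=> i x; exact: h0.
    by apply: eq_bigr => i _; exact: fh.
  - move=> _; rewrite m1E /density ge0_integral_prod_independent //.
    rewrite ltey_eq prode_fin_num // => i _; rewrite ge0_fin_numE //.
    by apply: integral_ge0 => w _; rewrite lee_fin.
have mG : measurable G.
  by apply: g_sigma_preimage_measurable GX => i; exact: measurableT_comp.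
move: m12; rewrite m1E m2E /density => ->.
rewrite -integral_cst //; apply: ge0_le_integral => //.
- by move=> w _; rewrite lee_fin; apply: prodr_ge0 => i _; exact: h0.
- by apply/measurable_funTS/measurable_EFinP; exact: (mprod _ mhp).
- by move=> w _; rewrite lee_fin; apply: ler_prod => i _; exact: h0C.
Qed.

End ConditionalProduct.

(** * Sub-Gaussian tails on events of the design points *)

Section SubgaussianTail.
Context dO dT (Omega : measurableType dO) (T : measurableType dT) (R : realType).
Variables (P : probability Omega R) (n : nat) (g : T -> R) (sigma : R).
Variables (X : {mfun Omega >-> T}) (Y : {mfun Omega >-> R}).
Variables (Xs : 'I_n -> {mfun Omega >-> T}) (Ys : 'I_n -> {mfun Omega >-> R}).
Hypothesis mg : measurable_fun setT g.
Hypothesis iidXY : iid P (with_sample X Y (fun i => Xs i) (fun i => Ys i)).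
Hypothesis subg : cond_subgaussian P X (fun w => Y w - g (X w)) sigma.
Hypothesis sigma_gt0 : 0 < sigma.

Let Z (i : 'I_n) w := (Xs i w, Ys i w).
Let Z0 w := (X w, Y w).

Let mZ i : measurable_fun setT (Z i).
Proof. by apply: measurable_fun_pair; exact: measurable_funPT. Qed.

Let mZ0 : measurable_fun setT Z0.
Proof. by apply: measurable_fun_pair; exact: measurable_funPT. Qed.

Let indepZ : mutually_independent P Z.
Proof.
move=> J B mB; pose B' o := if o is Some i then B i else [set: T * R].
have mB' o : measurable (B' o).
  by case: o => [i|]; [exact: mB|exact: measurableT].
have := iidXY.1 (Some @: J)%SET B' mB'.
rewrite big_imset /=; last by move=> i j _ _ [].
move=> <-; congr (P _); apply/seteqP; split=> w wB.
  move=> o /= /imsetP[i iJ ->]; exact: wB.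
by move=> i iJ; apply: (wB (Some i)) => /=; exact: imset_f.
Qed.

Let noise (x : T * R) : R := x.2 - g x.1.

Let mnoise : measurable_fun setT noise.
Proof. by apply: measurable_funB => //; exact: measurableT_comp. Qed.

Let mexp (c : R) : measurable_fun setT (fun x => expR (c * noise x)).
Proof.
by apply: measurableT_comp; [exact: measurable_expR|exact: measurable_funM].
Qed.

(** The sub-Gaussian hypothesis concerns the generic pair; equality of laws transfers its clipped
    conditional exponential moment to every sample pair, with the same [h]. *)
Let exp_noise_dominated (c : R) : exists h : T -> R,
  [/\ measurable_fun setT h, forall x, 0 <= h x <= expR (c ^+ 2 * sigma ^+ 2 / 2) &
    forall (i : 'I_n) B, measurable B ->
    (\int[P]_(w in (fst \o Z i) @^-1` B) (expR (c * noise (Z i w)))%:E =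
     \int[P]_(w in (fst \o Z i) @^-1` B) (h (Z i w).1)%:E)%E].
Proof.
have [h hE hC] := subg.2 c.
have [k [mk k0C kE]] := ge0_cond_expectation_clip (measurable_funPT X) (expR_ge0 _)
  (fun w => expR_ge0 _) hE hC.
exists k; split=> // i B mB.
have same_law (F : T * R -> R) : measurable_fun setT F -> (forall x, 0 <= F x) ->
    (\int[P]_(w in (fst \o Z i) @^-1` B) (F (Z i w))%:E =
     \int[P]_(w in X @^-1` B) (F (Z0 w))%:E)%E.
  move=> mF F0; pose FB x := F x * \1_(fst @^-1` B) x.
  have FB0 x : 0 <= FB x by rewrite mulr_ge0 // indicE.
  have mFB : measurable_fun setT FB.
    apply: measurable_funM => //; apply: measurable_indic.
    by rewrite -[X in measurable X]setTI; exact: measurable_fst.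
  transitivity (\int[P]_w (FB (Z i w))%:E)%E.
    exact: (integral_preimage_indic P (Z i)).
  transitivity (\int[P]_w (FB (Z0 w))%:E)%E; last first.
    exact/esym/(integral_preimage_indic P Z0).
  apply: ge0_integral_same_law => // D mD.
  exact: (iidXY.2 (Some i) None D mD).
rewrite (same_law (fun x => expR (c * noise x))) //.
rewrite (same_law (fun x => k x.1)) ?kE //.
- exact: measurableT_comp.
- by move=> x; case/andP: (k0C x.1).
Qed.

(** Chernoff's method carried out on [G]. The factor [P G] on the right is what later turns the
    union bound into an expected number of traces. *)
Lemma subgaussian_sum_tail (a : 'I_n -> R) (t : R) (G : set Omega) :
  0 < \sum_i a i ^+ 2 -> 0 <= t -> g_sigma_preimage (fun i => Xs i) G ->
  (P (G `&` [set w | (t <= \sum_i a i * (Ys i w - g (Xs i w)))%R]) <=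
   (expR (- (t ^+ 2 / (2 * sigma ^+ 2 * \sum_i a i ^+ 2))))%:E * P G)%E.
Proof.
set s := \sum_i _ => s0 t0 GX.
(* The minimizer of l ^+ 2 * sigma ^+ 2 * s / 2 - l * t. *)
pose l := t / (sigma ^+ 2 * s).
have l0 : 0 <= l by rewrite divr_ge0 // mulr_ge0 ?sqr_ge0 // ltW.
pose S w := \sum_i a i * (Ys i w - g (Xs i w)).
have mS : measurable_fun setT S.
  apply: measurable_sum => i; apply: measurable_funM => //.
  exact: (measurableT_comp mnoise (mZ i)).
have [h hP] := choice (fun i => exp_noise_dominated (l * a i)).
have mG : measurable G.
  by apply: g_sigma_preimage_measurable GX => i; exact: measurable_funPT.
have key : (\int[P]_(w in G) (expR (l * S w))%:E <=
    (expR (l ^+ 2 * sigma ^+ 2 * s / 2))%:E * P G)%E.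
  have -> : expR (l ^+ 2 * sigma ^+ 2 * s / 2) =
      \prod_i expR ((l * a i) ^+ 2 * sigma ^+ 2 / 2).
    rewrite -expR_sum /s mulr_sumr mulr_suml; congr expR.
    by apply: eq_bigr => i _; ring.
  under eq_integral => w _.
    have -> : expR (l * S w) = \prod_i expR (l * a i * noise (Z i w)).
      rewrite -expR_sum mulr_sumr; congr expR.
      by apply: eq_bigr => i _; rewrite mulrA.
    over.
  apply: (ge0_integral_prod_dominated mZ indepZ measurable_fst (h := h)
    (f := fun i x => expR (l * a i * noise x))) => //.
  - by move=> i; have [] := hP i.
  - by move=> i; have [] := hP i.
  - by move=> i B mB; have [_ _] := hP i; exact.
pose D := G `&` [set w | t <= S w].
have mD : measurable D.
  apply: measurableI => //.
  rewrite (_ : [set w | _] = S @^-1` `[t, +oo[%classic).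
    by rewrite -[X in measurable X]setTI; exact: mS.
  by apply/seteqP; split=> w /=; rewrite in_itv /= andbT.
have mE : measurable_fun setT (fun w => (expR (l * S w))%:E).
  apply/measurable_EFinP; apply: measurableT_comp; first exact: measurable_expR.
  exact: measurable_funM.
(* Multiplying by [expR (l * t)] leaves Markov's inequality for [expR (l * S w)] on [D]; for this
   [l] the exponents combine into that of [key]. *)
rewrite -/D -(@lee_pmul2l _ (expR (l * t))%:E) ?lte_fin ?expR_gt0 //.
rewrite muleA -EFinM -expRD -integral_cst //.
have -> : l * t + - (t ^+ 2 / (2 * sigma ^+ 2 * s)) = l ^+ 2 * sigma ^+ 2 * s / 2.
  rewrite /l.
  have [s1 s2] : s != 0 /\ sigma != 0 by rewrite !gt_eqF.
  by field; rewrite s1 s2.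
apply: le_trans key; apply: (@le_trans _ _ (\int[P]_(w in D) (expR (l * S w))%:E)%E).
  apply: ge0_le_integral => //.
  - by move=> w _; rewrite lee_fin expR_ge0.
  - exact: measurable_funTS.
  - by move=> w [_ tS]; rewrite lee_fin ler_expR ler_wpM2l.
apply: ge0_subset_integral => //.
- exact: measurable_funTS.
- exact: subIsetl.
Qed.

End SubgaussianTail.

(** * Bias of a local estimator *)

Section LocalEstimatorError.
Context (R : realType) (d n : nat).
Implicit Types (x y : d.-tuple R) (S V : set (d.-tuple R)).

(** Every admissible constant bounds the difference quotient, hence so does the infimum, which is
    finite because [L] provides an admissible constant. *)
Lemma lip_const_diam (g : d.-tuple R -> R) (L : R) V x y :
  lipschitz2_on g L V -> V x -> V y ->
  (`|g x - g y|%:E <= lip_const g V * diam V)%E.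
Proof.
move=> gL Vx Vy.
have dist_ge0 u u' : 0 <= @dist2 R d u u' by exact: sqrtr_ge0.
have lip_ge0 : (0 <= lip_const g V)%E.
  by apply: le_ereal_inf_tmp => _ [l [l0 _] <-]; rewrite lee_fin.
(* [L] itself may be negative, while only nonnegative constants are admissible. *)
have lip_le : (lip_const g V <= (Num.max L 0)%:E)%E.
  apply: ereal_inf_lbound => //; exists (Num.max L 0) => //; split.
    by rewrite le_max lexx orbT.
  move=> u u' Vu Vu'; apply: le_trans (gL u u' Vu Vu') _.
  by rewrite ler_wpM2r // le_max lexx.
have /fineK lipE : lip_const g V \is a fin_num.
  by rewrite ge0_fin_numE //; apply: le_lt_trans lip_le _; rewrite ltry.
have gdist : `|g x - g y| <= fine (lip_const g V) * dist2 x y.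
  have [d0|d0] := eqVneq (dist2 x y) 0.
    by apply: le_trans (gL x y Vx Vy) _; rewrite d0 !mulr0.
  have {}d0 : 0 < dist2 x y by rewrite lt_def d0 dist_ge0.
  rewrite -ler_pdivrMr // -lee_fin lipE.
  apply: le_ereal_inf_tmp => _ [l [l0 gl] <-].
  by rewrite lee_fin ler_pdivrMr //; exact: gl.
apply: (@le_trans _ _ (lip_const g V * (dist2 x y)%:E)%E).
  by rewrite -lipE -EFinM lee_fin.
apply: lee_wpmul2l => //; apply: ereal_sup_ubound.
by exists (x, y).
Qed.

Variables (X : 'I_n -> d.-tuple R) (Y : 'I_n -> R).

(** The error is the local average of the noise plus the local average of [g (X i) - g x]. The
    points counted in the latter lie in [V x] together with [x], so [lip_const_diam] bounds it. *)
Lemma local_estimator_error (g : d.-tuple R -> R) (L t : R) S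
    (V : d.-tuple R -> set (d.-tuple R)) x :
  lipschitz2_on g L S -> local_map S V -> S x -> local_count X (V x) != 0 ->
  `|\sum_i \1_(V x) (X i) * (Y i - g (X i))| <= t ->
  (`|local_estimator X Y V x - g x|%:E <=
   (t / local_count X (V x))%:E + lip_const g (V x) * diam (V x))%E.
Proof.
move=> gL VS Sx N0 St; have [Vxx VxS _] := VS x Sx.
have gLV : lipschitz2_on g L (V x) by move=> y z /VxS Sy /VxS Sz; exact: gL.
have bias y := @lip_const_diam g L (V x) y x gLV ^~ Vxx.
set B := (_ * diam _)%E in bias *.
have ind_ge0 i : 0 <= \1_(V x) (X i) :> R by rewrite indicE.
have N_gt0 : 0 < local_count X (V x) by rewrite lt_def N0 sumr_ge0.
have B0 : (0 <= B)%E by apply: le_trans (bias x Vxx); rewrite lee_fin.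
(* An infinite bias bound makes the claim trivial, and [B0] excludes the value -oo. *)
case: B => [b||] in bias B0 *; last 2 first.
- by rewrite addey // leey.
- by [].
rewrite -EFinD lee_fin.
set N := local_count X (V x) in N0 N_gt0 *.
have -> : local_estimator X Y V x - g x =
    (\sum_i \1_(V x) (X i) * (Y i - g (X i))) / N +
    (\sum_i \1_(V x) (X i) * (g (X i) - g x)) / N.
  rewrite -mulrDl -big_split /=.
  transitivity ((\sum_i Y i * \1_(V x) (X i) - g x * N) / N).
    by rewrite mulrBl mulfK.
  rewrite {1}/N /local_count mulr_sumr -sumrB.
  by congr (_ / _); apply: eq_bigr => i _; ring.
apply: le_trans (ler_normD _ _) _; rewrite !normrM !normfV (gtr0_norm N_gt0).
apply: lerD; first by rewrite ler_pM2r ?invr_gt0.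
rewrite ler_pdivrMr // mulr_sumr.
apply: le_trans (ler_norm_sum _ _ _) _; apply: ler_sum => i _.
rewrite normrM (ger0_norm (ind_ge0 i)) [leRHS]mulrC indicE.
case: (boolP (_ \in _)) => [|_]; last by rewrite !mul0r.
by rewrite inE !mul1r -lee_fin => /bias.
Qed.

End LocalEstimatorError.

(** * Union bound over the traces *)

Section UnionBound.
Context dO (Omega : measurableType dO) (R : realType).
Variable P : {measure set Omega -> \bar R}.

Lemma measure_bigsetU_le (I : Type) (s : seq I) (F : I -> set Omega) :
  (forall i, measurable (F i)) ->
  (P (\big[setU/set0]_(i <- s) F i) <= \sum_(i <- s) P (F i))%E.
Proof.
move=> mF; elim: s => [|i s IH]; first by rewrite !big_nil measure0.
rewrite !big_cons; apply: le_trans (measureU2 _ _ _) _ => //.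
  exact: bigsetU_measurable.
by rewrite leeD2l.
Qed.

End UnionBound.

(** The sum is the expected number of [b] for which [G b] occurs, which off the null set [M] is at
    most the number of traces on the sample. *)
Lemma sum_probability_traces dO dT (Omega : measurableType dO)
    (T : measurableType dT) (R : realType) (P : probability Omega R) (n v : nat)
    (X : 'I_n -> Omega -> T) (A : set (set T))
    (G : {ffun 'I_n -> bool} -> set Omega) (M : set Omega) :
  vc_dimension A v -> (forall b, measurable (G b)) -> measurable M ->
  P M = 0%E ->
  (forall b w, ~ M w -> G b w -> b \in traces A (fun i => X i w)) ->
  (\sum_b P (G b) <= (n.+1%:R ^+ v)%:E)%E.
Proof.
move=> vcA mG mM M0 Gtr.
under eq_bigr do rewrite -[X in P X]setIT -integral_indic //.
rewrite -ge0_integral_sum //; last first.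
  by move=> b; apply/measurable_EFinP; exact: measurable_indic.
rewrite -[leRHS]mule1 -[X in (_ * X)%E](probability_setT P) -integral_cst //.
apply: ae_ge0_le_integral => //.
- by move=> w _; apply: sume_ge0 => b _; rewrite lee_fin indicE.
- by apply: emeasurable_sum => b; apply/measurable_EFinP; exact: measurable_indic.
- by move=> w _; rewrite lee_fin exprn_ge0.
exists M; split=> // w /= Sw; apply: contrapT => Mw; apply: Sw => _.
rewrite sumEFin lee_fin -natrX.
have -> : \sum_b \1_(G b) w = #|[set b | w \in G b]%SET|%:R :> R.
  rewrite -sum1_card natr_sum [RHS]big_mkcond; apply: eq_bigr => b _.
  by rewrite indicE finset.inE; case: (_ \in _).
rewrite ler_nat; apply: leq_trans (card_traces (fun i => X i w) vcA).
apply/subset_leq_card/fintype.subsetP => b; rewrite finset.inE inE.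
exact: Gtr.
Qed.

(** The event is stated for 0/1 vectors in place of regions: a finite union suffices, and a single
    [E] serves every map with values in [A], however it depends on the outcome. *)
Lemma exists_good_event dO dT (Omega : measurableType dO)
    (T : measurableType dT) (R : realType) (P : probability Omega R)
    (n v : nat) (delta sigma : R) (g : T -> R)
    (X : {mfun Omega >-> T}) (Y : {mfun Omega >-> R})
    (Xs : 'I_n -> {mfun Omega >-> T}) (Ys : 'I_n -> {mfun Omega >-> R})
    (A : set (set T)) :
  0 < delta < 1 -> 0 < sigma -> measurable_fun setT g ->
  iid P (with_sample X Y (fun i => Xs i) (fun i => Ys i)) ->
  cond_subgaussian P X (fun w => Y w - g (X w)) sigma ->
  vc_dimension A v -> measurable_traces P (fun i => Xs i) A ->
  exists2 E : set Omega,
    measurable E /\ ((1 - 2 * delta)%:E <= P E)%E &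
    forall w b, E w -> b \in traces A (fun i => Xs i w) ->
      let N : R := \sum_i (b i)%:R in N != 0 ->
      `|\sum_i (b i)%:R * (Ys i w - g (Xs i w))| <=
      N * Num.sqrt (2 * sigma ^+ 2 / N * ln (n.+1%:R ^+ v / delta)).
Proof.
move=> /andP[d0 d1] s0 mg iidXY subg vcA trA.
set l := ln _.
have K0 : 0 < n.+1%:R ^+ v :> R by rewrite exprn_gt0.
have l0 : 0 < l.
  rewrite ln_gt0 // ltr_pdivlMr // mul1r; apply: lt_le_trans d1 _.
  by rewrite exprn_ege1 // ler1n.
(* The share of the failure probability given to one vector and one sign, to be weighted by
   [P (G b)]. *)
have expl : expR (- l) = delta / n.+1%:R ^+ v.
  by rewrite expRN lnK ?posrE ?divr_gt0 // invf_div.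
pose N (b : {ffun 'I_n -> bool}) : R := \sum_i (b i)%:R.
(* The threshold makes [t b ^+ 2 / (2 * sigma ^+ 2 * N b)] equal to [l]. *)
pose t b := N b * Num.sqrt (2 * sigma ^+ 2 / N b * l).
pose S (b : {ffun 'I_n -> bool}) w := \sum_i (b i)%:R * (Ys i w - g (Xs i w)).
have N_ge0 b : 0 <= N b by apply: sumr_ge0 => i _; rewrite ler0n.
have t_ge0 b : 0 <= t b by rewrite mulr_ge0 // sqrtr_ge0.
have mS b : measurable_fun setT (S b).
  apply: measurable_sum => i; apply: measurable_funM => //.
  by apply: measurable_funB => //; exact: (measurableT_comp mg (measurable_funPT _)).
(* Up to a null set, [G b] is the trace event; it lies in the sigma-algebra of the design points,
   where the tail bound applies. *)
have /choice[G GP] (b : {ffun 'I_n -> bool}) : exists G,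
    g_sigma_preimage (fun i => Xs i) G /\
    let F := [set w | b \in traces A (fun i => Xs i w)] in
    P.-negligible ((F `\` G) `|` (G `\` F)).
  by have [G GX nG] := trA b; exists G.
have mG b : measurable (G b).
  have [GX _] := GP b.
  by apply: g_sigma_preimage_measurable GX => i; exact: measurable_funPT.
have /choice[M MP] b := (GP b).2.
have mM b : measurable (M b) by have [] := MP b.
pose Mall := \big[setU/set0]_b M b.
have mMall : measurable Mall by exact: bigsetU_measurable.
have Mall0 : P Mall = 0%E.
  apply/eqP; rewrite -measure_le0; apply: le_trans (measure_bigsetU_le _ _ mM) _.
  by rewrite big1 // => b _; have [] := MP b.
have notM b w : ~ Mall w -> (b \in traces A (fun i => Xs i w)) <-> G b w.
  move=> Mw; have {}Mw : ~ M b w by move=> h; apply: Mw; rewrite /Mall (bigD1 b) //=; left.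
  have [_ _ sM] := MP b.
  by split=> h; apply: contrapT => h'; apply: Mw; apply: sM; [left|right].
have SE (e : bool) (b : {ffun 'I_n -> bool}) w :
    \sum_i (-1) ^+ e * (b i)%:R * (Ys i w - g (Xs i w)) = (-1) ^+ e * S b w.
  by rewrite /S mulr_sumr; apply: eq_bigr => i _; rewrite mulrA.
(* [e] selects the upper or the lower tail; the sign goes into the weights, whose squares still sum
   to [N b]. *)
pose U (e : bool) (b : {ffun 'I_n -> bool}) :=
  [set w | t b <= \sum_i (-1) ^+ e * (b i)%:R * (Ys i w - g (Xs i w))].
have UE e b : U e b = [set w | t b <= (-1) ^+ e * S b w].
  by apply/seteqP; split=> w; rewrite /U /= SE.
have mU e b : measurable (U e b).
  rewrite UE (_ : [set w | _] = (fun w => (-1) ^+ e * S b w) @^-1` `[t b, +oo[%classic).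
    rewrite -[X in measurable X]setTI.
    exact: (measurable_funM (@measurable_cst _ _ _ _ _ _) (mS b)).
  by apply/seteqP; split=> w /=; rewrite in_itv /= andbT.
(* The zero vector is excluded from the conclusion and has no positive sum of squares for the tail
   bound, so its bad event is empty. *)
pose Bad b := if N b == 0 then set0 else (G b `&` U false b) `|` (G b `&` U true b).
have mBad b : measurable (Bad b).
  rewrite /Bad; case: ifP => // _.
  by apply: measurableU; exact: measurableI.
have PU e b : N b != 0 ->
    (P (G b `&` U e b) <= (delta / n.+1%:R ^+ v)%:E * P (G b))%E.
  move=> Nb0.
  have aN : \sum_i ((-1) ^+ e * (b i)%:R) ^+ 2 = N b :> R.
    apply: eq_bigr => i _; rewrite exprMn sqrr_sign mul1r.
    by case: (b i); rewrite ?expr1n ?expr0n.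
  have := subgaussian_sum_tail mg iidXY subg s0
    (a := fun i => (-1) ^+ e * (b i)%:R) (t := t b) (G := G b).
  rewrite aN => /(_ _ (t_ge0 b) (GP b).1).
  rewrite (_ : t b ^+ 2 / _ = l); last first.
    rewrite exprMn sqr_sqrtr; last first.
      by rewrite mulr_ge0 ?ltW // divr_gt0 ?mulr_gt0 ?exprn_gt0 // lt_def Nb0 N_ge0.
    by field; rewrite Nb0 gt_eqF.
  by rewrite expl; apply; rewrite lt_def Nb0 N_ge0.
have c_ge0 : 0 <= delta / n.+1%:R ^+ v by rewrite divr_ge0 // ltW.
(* The factor 2 accounts for the two signs. *)
have PBad b : (P (Bad b) <= (2 * (delta / n.+1%:R ^+ v))%:E * P (G b))%E.
  rewrite /Bad; case: ifPn => [_|Nb0].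
    by rewrite measure0 mule_ge0 // lee_fin mulr_ge0.
  have mGU e : measurable (G b `&` U e b) by exact: measurableI.
  apply: le_trans (measureU2 P (mGU _) (mGU _)) _.
  rewrite mulr_natl mulr2n EFinD ge0_muleDl ?lee_fin //.
  by apply: leeD; exact: PU.
pose Ball := \big[setU/set0]_b Bad b.
have mBall : measurable Ball by exact: bigsetU_measurable.
have PBall : (P Ball <= (2 * delta)%:E)%E.
  apply: le_trans (measure_bigsetU_le _ _ mBad) _.
  apply: le_trans (lee_sum _ (fun b _ => PBad b)) _.
  rewrite -ge0_sume_distrr //.
  (* The bound on the expected number of traces cancels the denominator in the share of each
     vector. *)
  apply: (@le_trans _ _ ((2 * (delta / n.+1%:R ^+ v))%:E * (n.+1%:R ^+ v)%:E)%E).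
    apply: lee_wpmul2l; first by rewrite lee_fin mulr_ge0.
    apply: (sum_probability_traces vcA mG mMall Mall0) => b w Mw Gbw.
    exact/(notM b w Mw).
  by rewrite -EFinM -mulrA divfK ?gt_eqF.
exists (~` (Ball `|` Mall)).
  have mBM : measurable (Ball `|` Mall) by exact: measurableU.
  split; first exact: measurableC.
  rewrite probability_setC // EFinB leeB //.
  apply: le_trans (measureU2 P mBall mMall) _.
  by rewrite [X in (_ + X)%E]Mall0 adde0.
move=> w b /not_orP[Bw Mw] bw /= Nb0.
have Gbw : G b w by apply/(notM b w Mw).
have {}Bw : ~ Bad b w by move=> h; apply: Bw; rewrite /Ball (bigD1 b) //=; left.
have Ub (e : bool) : (-1) ^+ e * S b w <= t b.
  rewrite leNgt; apply/negP => /ltW tS; apply: Bw.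
  rewrite /Bad (negbTE Nb0); move: tS.
  by case: e => tS; [right|left]; split=> //; rewrite UE.
rewrite -/N -/(S b w) ler_norml.
have := Ub true; have := Ub false.
rewrite expr0 expr1 mul1r mulN1r => -> ; rewrite andbT lerNl.
exact.
Qed.

(** * Error bound for local maps on the good event *)

Theorem theorem4 (R : realType) (dO : measure_display)
  (Omega : measurableType dO) (P : probability Omega R)
  (d n v : nat) (delta sigma L : R)
  (S : set (d.-tuple R)) (g : d.-tuple R -> R)
  (X : {mfun Omega >-> d.-tuple R}) (Y : {mfun Omega >-> R})
  (Xs : 'I_n -> {mfun Omega >-> d.-tuple R}) (Ys : 'I_n -> {mfun Omega >-> R})
  (V : Omega -> d.-tuple R -> set (d.-tuple R))
  (A : set (set (d.-tuple R))) :
  (0 < d)%N -> (0 < n)%N -> 0 < delta < 2^-1 -> 0 < sigma ->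
  measurable S -> P (X @^-1` S) = 1%E ->
  is_cond_expectation P X Y g ->
  iid P (with_sample X Y (fun i => Xs i) (fun i => Ys i)) ->
  cond_subgaussian P X (fun w => Y w - g (X w)) sigma ->
  lipschitz2_on g L S ->
  (forall w, local_map S (V w)) ->
  vc_dimension A v -> (forall w x, S x -> A (V w x)) ->
  measurable_traces P (fun i => Xs i) A ->
  exists2 E : set Omega,
    measurable E /\ ((1 - 2 * delta)%:E <= P E)%E &
    forall w, E w -> forall x, S x ->
      ((`|local_estimator (fun i => Xs i w) (fun i => Ys i w) (V w) x - g x|)%:E
       <= local_bound (fun i => Xs i w) g sigma delta v (V w x))%E.
Proof.
move=> d_gt0 n_gt0 /andP[del0 del1] s0 mS PS [_ mg _ _] iidXY subg gL VS vcA VA trA.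
have [|E [mE PE] goodE] := exists_good_event _ s0 mg iidXY subg vcA trA (delta := delta).
  by rewrite del0 (lt_le_trans del1) // invf_le1 // ler1n.
exists E => // w Ew x Sx; rewrite /local_bound.
case: ifPn => [_|N0]; first by rewrite leey.
(* The vector cut out by the region at [x] is a trace because the region belongs to [A], so the one
   good event covers every [x]. *)
pose b := [ffun i => `[< V w x (Xs i w) >]].
have bE i : (b i)%:R = \1_(V w x) (Xs i w) :> R.
  by rewrite ffunE indicE; congr (nat_of_bool _)%:R; apply/asboolP/idP; rewrite inE.
have btr : b \in traces A (fun i => Xs i w).
  by apply/tracesP; exists (V w x); [exact: VA|move=> i; rewrite ffunE].
have NE : \sum_i (b i)%:R = local_count (fun i => Xs i w) (V w x) :> R.
  by apply: eq_bigr.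
have := goodE w b Ew btr; rewrite /= NE => /(_ N0).
under eq_bigr do rewrite bE.
move=> /(local_estimator_error gL (VS w) Sx N0).
(* The factor [local_count] in the threshold cancels against the normalization of the estimator. *)
by rewrite mulrC mulKf.
Qed.
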